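(* Let $D$ be the unit simplex $\{(p_0,\ldots,p_K)\in[0,1]^{K+1}:\sum_k p_k=1\}$. If a function $h:D\to[L,U]\subseteq\mathbb{R}$ is continuous, then for every $\epsilon>0$ there exists a computable function $h_\epsilon:D\to[L,U]$ such that $\|h-h_\epsilon\|_\infty<\epsilon$.
   Context: Let $X=\{0,1,\ldots,K\}$. For $x\in X^n$, $p_k(x)=|\{i:x_i=k\}|/n$. A function $h$ on $D$ is computable if it takes values in a finite set $Y$ and the family $f_n:X^n\to Y$, $f_n(x)=h(p_0(x),\ldots,p_K(x))$, is computable in the following model. A network is a triple $(n,G,\mathcal L)$: $G$ is a connected undirected graph without self-arcs on $n\ge2$ nodes $\{1,\ldots,n\}$; $d(i)$ is the degree of node $i$; the port labeling $\mathcal L$ assigns to the edges at each node $i$ distinct port numbers in $\{0,1,\ldots,d(i)\}$. An algorithm is a family of deterministic finite automata $(A_d)_{d=1,2,\ldots}$, where $A_d$ is a map from $X\times Z_d\times(Y\cup\{\emptyset\})\times M^d$ into itself not changing the $X$-component. Here the internal memory set $Z_d$, the output set $Y$ and the message set $M$ are finite, $Z_d$ and $M$ contain a default symbol $\emptyset$, and $Z_d$ may depend on $d$; none of these depend on $n$. Node $i$ starts with initial value $x_i\in X$, with memory $z_i(0)$, output $y_i(0)$ and all outgoing messages equal to $\emptyset$. Let $j_1,\ldots,j_{d(i)}$ be the neighbors of $i$ in the order of the port numbers at $i$, and let $p_k$ be the index, in the corresponding enumeration at node $j_k$, of the edge from $j_k$ to $i$. At each time step every node $i$ updates synchronously $$[x_i,z_i(t+1),y_i(t+1);m_{i,1}(t+1),\ldots,m_{i,d(i)}(t+1)]=A_{d(i)}[x_i,z_i(t),y_i(t);m_{j_1,p_1}(t),\ldots,m_{j_{d(i)},p_{d(i)}}(t)].$$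 The algorithm terminates with final output $y^*\in Y$ if there is a time $t'$ with $y_i(t)=y^*$ for all $i$ and all $t\ge t'$. The family $(f_n)$ is computable if there is a family $(A_d)$ such that for every $n$, every network with $n$ nodes, and all initial values $x_1,\ldots,x_n$, the algorithm terminates with final output $f_n(x_1,\ldots,x_n)$. *)

(* Defs.v *)
From HB Require Import structures.
From mathcomp Require Import all_boot all_order all_algebra finmap.
From mathcomp Require Import all_classical all_reals all_analysis.

Set Implicit Arguments.
Unset Strict Implicit.
Unset Printing Implicit Defensive.

Import Order.TTheory GRing.Theory Num.Theory.
Import numFieldNormedType.Exports.

Local Open Scope ring_scope.
Local Open Scope classical_set_scope.

(* Nodes are numbered from 0.  [port i j] is the port number given at node [i]
   to the edge joining [i] and [j]; its value is irrelevant when there is no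
   such edge.  The port numbers at [i] lie in {0, ..., d(i)}, which has one
   element more than needed. *)
Record network (n : nat) := Network {
  edge : rel 'I_n;
  port : 'I_n -> 'I_n -> nat;
  network_size : (1 < n)%N;
  edge_irrefl : irreflexive edge;
  edge_sym : symmetric edge;
  edge_connected : forall i j, connect edge i j;
  port_bound : forall i j, edge i j -> (port i j <= #|[pred k | edge i k]|)%N;
  port_inj : forall i j k,
    edge i j -> edge i k -> port i j = port i k -> j = k
}.

Section Network.
Variables (n : nat) (N : network n).

Definition degree (i : 'I_n) : nat := #|[pred j | edge N i j]|.

Definition nbr_seq (i : 'I_n) : seq 'I_n :=
  sort (fun j k => port N i j <= port N i k)%N (enum [pred j | edge N i j]).

Lemma size_nbr_seq i : size (nbr_seq i) == degree i.
Proof. by rewrite size_sort -cardE. Qed.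

Definition nbr (i : 'I_n) : (degree i).-tuple 'I_n := Tuple (size_nbr_seq i).

Lemma mem_nbr_seq i j : (j \in nbr_seq i) = edge N i j.
Proof. by rewrite mem_sort mem_enum. Qed.

Lemma back_index_subproof (i : 'I_n) (k : 'I_(degree i)) :
  (index i (nbr_seq (tnth (nbr i) k)) < degree (tnth (nbr i) k))%N.
Proof.
have: tnth (nbr i) k \in nbr_seq i := mem_tnth k (nbr i).
move: (tnth _ k) => j; rewrite mem_nbr_seq edge_sym -mem_nbr_seq => ij.
by rewrite -(eqP (size_nbr_seq j)) index_mem.
Qed.

(* The place of [i] in the enumeration of the neighbours of its [k]-th
   neighbour. *)
Definition back_index (i : 'I_n) (k : 'I_(degree i)) :
    'I_(degree (tnth (nbr i) k)) :=
  Ordinal (back_index_subproof k).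

End Network.

(* [None : option Y] is the empty output.  The component at [d = 0] is never
   used, since every node of a network has a positive degree. *)
Record algorithm (X Y : finType) := Algorithm {
  memory : nat -> finType;
  memory0 : forall d, memory d;
  message : finType;
  message0 : message;
  automaton : forall d,
    X * memory d * option Y * d.-tuple message ->
    X * memory d * option Y * d.-tuple message;
  automaton_input : forall d s, (@automaton d s).1.1.1 = s.1.1.1
}.

Section Execution.
Variables (X Y : finType) (A : algorithm X Y) (n : nat) (N : network n).

(* For each node: initial value, memory, output, outgoing messages. *)
Definition configuration := forall i : 'I_n,
  X * memory A (degree N i) * option Y * (degree N i).-tuple (message A).

Definition initial_configuration (x : {ffun 'I_n -> X}) : configuration :=
  fun i => (x i, memory0 A _, None, [tuple of nseq _ (message0 A)]).

Definition incoming (c : configuration) (i : 'I_n) :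
    (degree N i).-tuple (message A) :=
  [tuple tnth (c (tnth (nbr N i) k)).2 (back_index k) | k < degree N i].

Definition next_configuration (c : configuration) : configuration :=
  fun i => automaton ((c i).1, incoming c i).

Definition run (x : {ffun 'I_n -> X}) (t : nat) : configuration :=
  iter t next_configuration (initial_configuration x).

Definition output (c : configuration) (i : 'I_n) : option Y := (c i).1.2.

Definition terminates_with (x : {ffun 'I_n -> X}) (y : Y) : Prop :=
  exists t', forall t, (t' <= t)%N -> forall i, output (run x t) i = Some y.

End Execution.

Definition computable_family (X Y : finType)
    (f : forall n, {ffun 'I_n -> X} -> Y) : Prop :=
  exists A : algorithm X Y,
    forall (n : nat) (N : network n) (x : {ffun 'I_n -> X}),
      terminates_with A N x (f n x).

Definition unit_simplex (R : realType) (K : nat) : set 'rV[R]_K.+1 :=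
  [set p : 'rV[R]_K.+1 | (forall k, 0 <= p 0 k <= 1) /\ \sum_k p 0 k = 1].
Arguments unit_simplex R K : clear implicits.

Definition frequencies (R : realType) (K n : nat) (x : {ffun 'I_n -> 'I_K.+1}) :
    'rV[R]_K.+1 :=
  \row_k (#|[set i | x i == k]%SET|%:R / n%:R).

(* Functions on the simplex are total functions on row vectors, of which only
   the values on the simplex matter.  For [n = 0] there are no frequencies, so
   [f 0] is unconstrained. *)
Definition computable_on_simplex (R : realType) (K : nat)
    (h : 'rV[R]_K.+1 -> R) : Prop :=
  exists Y : {fset R}, set_fun (unit_simplex R K) [set` Y] h /\
  exists f : forall n, {ffun 'I_n -> 'I_K.+1} -> Y,
    (forall n x, (0 < n)%N -> val (f n x) = h (frequencies R x)) /\
    computable_family f.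

Definition sup_norm (R : realType) (T : Type) (D : set T) (f : T -> R) : \bar R :=
  ereal_sup [set `|f p|%:E | p in D].

(* Main.v *)
(* Fix a large m and let h_eps be constant on the cells of the simplex cut out by
   the tests [q / m <= p_k], with value h at some point of the cell: h is
   uniformly continuous, and points of a common cell have coordinates within 1/m.
   It remains to decide, in finite memory, whether the sum of bounded weights
   [w (x i)] over the n nodes is at least [n * c].

   A node with [w (x i) > c] releases [w (x i) - c] tokens, and one with
   [w (x i) < c] has [c - w (x i)] holes, which absorb tokens.  At each step, all
   the tokens at a node leave it through its ports in round-robin order.  If there
   are at most [C * d] of them at each node of degree d, then at most C use each
   port, so the bound persists.  As long as some token moves, every node is visited
   infinitely often; hence in the end no tokens or no holes remain, and a hole
   remains for ever exactly when the sum is smaller than [n * c].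

   The nodes detect the holes with two counters, neither of which may run ahead of
   those of the neighbours by more than one.  The quiet counter ticks at nodes
   without holes: a permanent hole blocks all the quiet counters, while they all
   grow for ever if the holes vanish.  The alarm counter ticks at nodes with holes
   and at nodes having a neighbour with a larger alarm counter: all the alarm
   counters grow for ever if there is a permanent hole, and they are bounded if the
   holes vanish.  So it is enough to output which counter ticked last. *)

Require Import Defs.
From mathcomp Require Import all_boot all_order all_algebra finmap.
From mathcomp Require Import all_classical all_reals all_analysis.
From mathcomp Require Import zify lra.
Import Order.TTheory GRing.Theory Num.Theory.
Import numFieldNormedType.Exports.
Local Open Scope ring_scope.
Local Open Scope classical_set_scope.

Set Implicit Arguments.
Unset Strict Implicit.
Unset Printing Implicit Defensive.

(** * Neighbours, ports and connectedness *)

Section Network.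
Local Open Scope nat_scope.
Variables (n : nat) (N : network n).

Lemma nbr_seq_uniq i : uniq (nbr_seq N i).
Proof. by rewrite sort_uniq enum_uniq. Qed.

Lemma degree_gt0 i : 0 < degree N i.
Proof.
have [j ji] : exists j : 'I_n, j != i.
  have n1 := network_size N.
  have n0 : 0 < n by apply: ltnW.
  case: (eqVneq (i : nat) 0) => i0.
    by exists (Ordinal n1); rewrite -val_eqE /= i0.
  by exists (Ordinal n0); rewrite -val_eqE /= eq_sym.
have /connectP[[|k p] /=] := edge_connected N i j.
  by move=> _ e; rewrite e eqxx in ji.
by case/andP => ik _ _; apply/card_gt0P; exists k.
Qed.

Lemma sum_nbr_seq i (g : 'I_n -> nat) :
  \sum_(j <- nbr_seq N i) g j = \sum_(j | edge N i j) g j.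
Proof.
by rewrite (perm_big (enum [pred j | edge N i j])) ?perm_sort //= big_enum.
Qed.

(** Double counting: each port of each node is the receiving end of exactly one neighbour. *)
Lemma sum_received (phi : 'I_n -> nat -> nat) :
  \sum_i \sum_(j <- nbr_seq N i) phi j (index i (nbr_seq N j)) =
  \sum_i \sum_(k < degree N i) phi i k.
Proof.
under eq_bigr do rewrite sum_nbr_seq.
rewrite (exchange_big_dep xpredT) //=; apply: eq_bigr => j _.
under eq_bigl do rewrite edge_sym.
rewrite -sum_nbr_seq (big_nth j) (eqP (size_nbr_seq N j)) big_mkord.
apply: eq_bigr => k _.
by rewrite index_uniq ?nbr_seq_uniq // (eqP (size_nbr_seq N j)).
Qed.

Lemma network_ind (P : 'I_n -> Prop) v :
  P v -> (forall i j, edge N i j -> P i -> P j) -> forall i, P i.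
Proof.
move=> Pv step i; have /connectP[p] := edge_connected N v i.
elim: p v Pv => [|j p IHp] v Pv /=; first by move=> _ ->.
by case/andP => vj pj; apply: IHp pj; apply: step vj Pv.
Qed.

End Network.

(** * Local rules and their compilation to automata *)

Record local_rule (X : Type) (S : nat -> Type) (M Y : Type) := LocalRule {
  start : forall d, X -> S d;
  send : forall d, S d -> nat -> M;
  update : forall d, S d -> seq M -> S d;
  answer : forall d, S d -> Y
}.

Section Trajectory.
Variables (X : Type) (S : nat -> Type) (M Y : Type).
Variables (r : local_rule X S M Y) (n : nat) (N : network n) (x : 'I_n -> X).

Fixpoint trajectory (t : nat) : forall i, S (degree N i) :=
  if t is t'.+1 then
    let s := trajectory t' in
    fun i => update r (s i)
      [seq send r (s j) (index i (nbr_seq N j)) | j <- nbr_seq N i]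
  else fun i => start r (degree N i) (x i).

End Trajectory.

Section Compilation.
Local Open Scope nat_scope.
Variables (X : finType) (S : nat -> finType) (M Y : finType) (m0 : M).
Variable r : local_rule X S M Y.

(* The memory [None] marks the step at which the initial values are read. *)
Definition rule_automaton d
    (c : X * option (S d) * option Y * d.-tuple M) :
    X * option (S d) * option Y * d.-tuple M :=
  let x := c.1.1.1 in
  let s := if c.1.1.2 is Some s then update r s c.2 else start r d x in
  (x, Some s, Some (answer r s), [tuple send r s k | k < d]).

Definition rule_algorithm : algorithm X Y :=
  @Algorithm X Y (fun d => option (S d)) (fun=> None) M m0
    rule_automaton (fun d s => erefl).

(** The automaton lags one step behind the rule: its first step reads the initial value and ignores
    the default messages. *)
Lemma run_rule_algorithm n (N : network n) (x : {ffun 'I_n -> X}) t i :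
  run rule_algorithm N x t.+1 i =
    (x i, Some (trajectory r N x t i), Some (answer r (trajectory r N x t i)),
     [tuple send r (trajectory r N x t i) k | k < degree N i]).
Proof.
elim: t i => [//|t IHt] i.
rewrite -[LHS]/(next_configuration (run rule_algorithm N x t.+1) i).
move: (run _ _ _ t.+1) IHt => c IHt.
have inc : incoming c i = [seq send r (trajectory r N x t j)
    (index i (nbr_seq N j)) | j <- nbr_seq N i] :> seq M.
  apply: (@eq_from_nth _ m0) => [|k].
    by rewrite size_tuple size_map (eqP (size_nbr_seq N i)).
  rewrite size_tuple => kd; rewrite -(tnth_nth _ _ (Ordinal kd)).
  rewrite tnth_mktuple IHt /= tnth_mktuple.
  rewrite (nth_map i) ?(eqP (size_nbr_seq N i)) //=.
  by rewrite (tnth_nth i).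
by rewrite /next_configuration /= /rule_automaton IHt /= inc.
Qed.

Lemma computable_rule (f : forall n, {ffun 'I_n -> X} -> Y) :
  (forall n (N : network n) (x : {ffun 'I_n -> X}), exists t0, forall t, t0 <= t ->
     forall i, answer r (trajectory r N x t i) = f n x) ->
  computable_family f.
Proof.
move=> rf; exists rule_algorithm => n N x; have [t0 t0P] := rf n N x.
exists t0.+1 => -[//|t] t0t i.
by rewrite /output run_rule_algorithm /= t0P.
Qed.

End Compilation.

(** * Finitely many rules run in parallel *)

Section Product.
Variables (T : finType) (X : Type) (S : nat -> Type) (M Y : Type).
Variable r : T -> local_rule X S M Y.

Definition product_rule :
    local_rule X (fun d => {ffun T -> S d}) {ffun T -> M} {ffun T -> Y} :=
  LocalRule (fun d x => [ffun u => start (r u) d x])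
    (fun d s k => [ffun u => send (r u) (s u) k])
    (fun d s ms => [ffun u => update (r u) (s u) [seq m u | m : {ffun T -> M} <- ms]])
    (fun d s => [ffun u => answer (r u) (s u)]).

Lemma trajectory_product n (N : network n) (x : 'I_n -> X) t i u :
  trajectory product_rule N x t i u = trajectory (r u) N x t i.
Proof.
elim: t i => [|t IHt] i /=; rewrite ffunE //; congr update => //.
by rewrite -map_comp; apply: eq_map => j /=; rewrite ffunE IHt.
Qed.

End Product.

(** * Monotone sequences of natural numbers *)

Section NatSequences.
Local Open Scope nat_scope.

Lemma bounded_nat_stabilizes (s : nat -> nat) B :
  (forall t, s t <= s t.+1) -> (forall t, s t <= B) ->
  exists T, forall t, T <= t -> s t = s T.
Proof.
move=> incr bound.
have {}incr : {homo s : t t' / t <= t'} by apply: homo_leq => //; apply: leq_trans.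
suff H k : forall T, B - s T <= k -> exists T, forall t, T <= t -> s t = s T.
  exact: (H B 0 (leq_subr _ _)).
elim: k => [|k IHk] T BT.
  by exists T => t /incr; have := bound t; lia.
have [/existsNP[t /not_implyP[Tt]]|] :=
  pselect (~ forall t, T <= t -> s t = s T); last first.
  by move=> /contrapT H; exists T.
move=> neq; apply: (IHk t); have := incr _ _ Tt; have := bound t; lia.
Qed.

Lemma fin_eventually (I : finType) (P : nat -> I -> Prop) :
  (forall i, exists T, forall t, T <= t -> P t i) ->
  exists T, forall t, T <= t -> forall i, P t i.
Proof.
move=> /fin_all_exists[T TP]; exists (\max_i T i) => t Tt i.
by apply: TP; apply: leq_trans Tt; apply: leq_bigmax.
Qed.

Lemma unbounded_tick (s : nat -> nat) T :
  (forall t, s t <= s t.+1) -> (forall m, exists t, m <= s t) ->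
  exists2 t, T <= t & s t < s t.+1.
Proof.
move=> incr unb; apply: contrapT => H.
have noinc k : s (T + k) <= s T.
  elim: k => [|k IHk]; rewrite ?addn0 // addnS; apply: leq_trans IHk.
  by rewrite leqNgt; apply/negP => lt; apply: H; exists (T + k); rewrite ?leq_addr.
have {}incr : {homo s : t t' / t <= t'} by apply: homo_leq => //; apply: leq_trans.
have [t] := unb (s T).+1.
by have := noinc t; have := incr t (T + t) (leq_addl _ _); lia.
Qed.

(** Here [b] remembers which counter ticked last. Once [s'] has stopped, the next tick of [s] sets
    [b] to [v] for good. *)
Lemma latch_eventually (b : nat -> bool) (v : bool) (s s' : nat -> nat) B :
  (forall t, s t < s t.+1 -> s' t.+1 = s' t -> b t.+1 = v) ->
  (forall t, s t.+1 = s t -> s' t.+1 = s' t -> b t.+1 = b t) ->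
  (forall t, s t <= s t.+1) -> (forall t, s' t <= s' t.+1) ->
  (forall m, exists t, m <= s t) -> (forall t, s' t <= B) ->
  exists T, forall t, T <= t -> b t = v.
Proof.
move=> btick bkeep s_incr s'_incr s_unb s'_bound.
have [T' T'P] := bounded_nat_stabilizes s'_incr s'_bound.
have [T TT' tick] := unbounded_tick T' s_incr s_unb.
have s'c t : T' <= t -> s' t.+1 = s' t by move=> ?; rewrite !T'P //; lia.
exists T.+1; elim=> // t IHt; rewrite leq_eqVlt => /orP[/eqP[<-]|].
  by apply: btick => //; apply: s'c.
rewrite ltnS => Tt; have s't : s' t.+1 = s' t by apply: s'c; lia.
have := s_incr t; rewrite leq_eqVlt => /orP[/eqP st|st].
  by rewrite bkeep // IHt.
exact: btick.
Qed.

End NatSequences.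

(** * Counters that stay close to those of the neighbours *)

Section Ticking.
Local Open Scope nat_scope.
Variables (n : nat) (N : network n).

Definition lagging (c : 'I_n -> nat) i := all (fun j => c i <= c j) (nbr_seq N i).

Variables (allowed : nat -> 'I_n -> bool) (c : nat -> 'I_n -> nat).
Hypothesis c0 : forall i, c 0 i = 0.
Hypothesis cS : forall t i,
  c t.+1 i = c t i + (allowed t i && lagging (c t) i).

Lemma laggingP t i :
  reflect (forall j, edge N i j -> c t i <= c t j) (lagging (c t) i).
Proof.
apply: (iffP allP) => H j; have := H j; first by rewrite mem_nbr_seq.
by rewrite -mem_nbr_seq.
Qed.

Lemma ticking_incr t i : c t i <= c t.+1 i.
Proof. by rewrite cS leq_addr. Qed.

Lemma ticking_smooth t i j : edge N i j -> c t i <= (c t j).+1.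
Proof.
elim: t i j => [|t IHt] i j ij; first by rewrite !c0.
have := IHt i j ij; rewrite !cS.
case: laggingP => [/(_ j ij)|_]; rewrite ?andbF; case: (allowed t i) => /=; lia.
Qed.

(** A node whose counter equals the global lower bound is lagging, so it ticks: the minimum grows at
    each step. *)
Lemma ticking_unbounded T :
  (forall t, T <= t -> forall i, allowed t i) ->
  forall m, exists t, forall i, m <= c t i.
Proof.
move=> al m; exists (T + m) => i; elim: m i => // m IHm i.
rewrite addnS cS al ?leq_addr //=.
have := IHm i; rewrite leq_eqVlt => /orP[/eqP mi|]; last by lia.
suff -> : lagging (c (T + m)) i by lia.
by apply/laggingP => j _; rewrite -mi.
Qed.

(** The counter of [v] stays at 0, and the bound grows by one per edge away from [v]. *)
Lemma ticking_bounded v :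
  (forall t, ~~ allowed t v) -> forall i, exists B, forall t, c t i <= B.
Proof.
move=> nal; apply: (network_ind (N := N) (v := v)) => [|i j ij [B BP]].
  by exists 0; elim=> [|t IHt]; rewrite ?c0 // cS (negPf (nal t)) addn0.
exists B.+1 => t; rewrite edge_sym in ij.
by have := ticking_smooth t ij; have := BP t; lia.
Qed.

Definition leading (c : 'I_n -> nat) i := has (fun j => c i < c j) (nbr_seq N i).

Variable source : nat -> 'I_n -> bool.
Hypothesis allowedE : forall t i, allowed t i = source t i || leading (c t) i.

(** Without sources, a node ticks only below some neighbour, so the maximum never increases. *)
Lemma pulled_bounded T :
  (forall t, T <= t -> forall i, ~~ source t i) ->
  forall i, exists B, forall t, c t i <= B.
Proof.
move=> nsrc i; exists (\max_j c T j) => t.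
have incr : {homo c^~ i : t t' / t <= t'}.
  by apply: homo_leq => //; [apply: leq_trans | move=> ?; apply: ticking_incr].
have [/incr tT|/ltnW Tt] := leqP t T.
  by apply: leq_trans tT (leq_bigmax _).
rewrite -(subnKC Tt); elim: (t - T) (i) => [|k IHk] j.
  by rewrite addn0; apply: leq_bigmax.
rewrite addnS cS allowedE (negPf (nsrc _ (leq_addr _ _) _)) /=.
case ld: leading; last by rewrite addn0; apply: IHk.
have [l _ jl] := hasP ld.
have := IHk l; move: jl => /=; case: lagging => /=; lia.
Qed.

(** Once all counters are at least [m], the source passes [m], and then each node beyond [m] pulls
    its neighbours along. *)
Lemma pulled_unbounded v :
  (forall t, source t v) -> forall m, exists t, forall i, m <= c t i.
Proof.
move=> src; elim=> [|m [t tP]]; first by exists 0.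
have incr i : {homo c^~ i : t t' / t <= t'}.
  by apply: homo_leq => //; [apply: leq_trans | move=> ?; apply: ticking_incr].
suff H i : exists T, forall t', T <= t' -> m < c t' i.
  by have [T TP] := fin_eventually H; exists T => i; apply: TP.
suff [t' _ mt'] : exists2 t', t <= t' & m < c t' i.
  by exists t' => s /(incr i); lia.
have tickm t' j : t <= t' -> allowed t' j -> m < c t'.+1 j.
  move=> tt' al; have := leq_trans (tP j) (incr j _ _ tt').
  rewrite leq_eqVlt => /orP[/eqP mj|]; last by rewrite cS; lia.
  rewrite cS al -mj; suff -> : lagging (c t') j by rewrite addn1.
  by apply/laggingP => l _; rewrite -mj; apply: leq_trans (tP l) (incr l _ _ tt').
move: i; apply: (network_ind (N := N) (v := v)) => [|i j ij [t' tt' it']].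
  by exists t.+1; [lia | apply: tickm; rewrite ?allowedE ?src].
have := leq_trans (tP j) (incr j _ _ tt').
rewrite leq_eqVlt => /orP[/eqP mj|]; last by exists t'.
exists t'.+1; [lia|apply: tickm => //].
rewrite allowedE; apply/orP; right; apply/hasP; exists i.
  by rewrite mem_nbr_seq edge_sym.
by rewrite -mj.
Qed.

End Ticking.

(** * Round-robin circulation of tokens and filling of holes *)

Section Tokens.
Local Open Scope nat_scope.
Variables (n : nat) (N : network n).

(** If tokens are dealt to the ports [d-1], ..., [0] cyclically, [(e + k) %/ d] of the first [e] use
    port [k]; this counts the next [a]. *)
Definition flow d e a k := (e + a + k) %/ d - (e + k) %/ d.

Lemma flow_sum d e a : 0 < d -> \sum_(k < d) flow d e a k = a.
Proof.
move=> d0.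
(* Hermite's identity: raising [x] by one replaces the term [x %/ d] by [(x + d) %/ d]. *)
have hermite x : \sum_(k < d) (x + k) %/ d = x.
  elim: x => [|x IHx].
    by rewrite big1 // => k _; rewrite add0n divn_small.
  case: d d0 IHx => // d _ IHx.
  rewrite big_ord_recr /= addSnnS divnDr // divnn /=.
  rewrite big_ord_recl /= addn0 in IHx.
  under eq_bigr do rewrite addSnnS.
  by rewrite addn1 addnS addnC IHx.
suff : \sum_(k < d) flow d e a k + \sum_(k < d) (e + k) %/ d =
    \sum_(k < d) (e + a + k) %/ d by rewrite !hermite; lia.
rewrite -big_split; apply: eq_bigr => k _.
by rewrite /flow /= subnK //; apply: leq_div2r; lia.
Qed.

Lemma flow_mod d e a k : 0 < d -> flow d (e %% d) a k = flow d e a k.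
Proof.
move=> d0; rewrite /flow [in RHS](divn_eq e d) -!addnA !divnMDl //.
by rewrite subnDl.
Qed.

Lemma flow_le d e a k m : 0 < d -> a <= m * d -> flow d e a k <= m.
Proof.
move=> d0 am; rewrite /flow leq_subLR [leqRHS]addnC -divnMDl //.
apply: leq_div2r; lia.
Qed.

(** Tokens emitted before time [t], tokens about to leave, and holes. Truncated subtraction lets
    arriving tokens fill holes first. *)
Variables (e a h : nat -> 'I_n -> nat).

Definition received t i :=
  \sum_(j <- nbr_seq N i)
     flow (degree N j) (e t j) (a t j) (index i (nbr_seq N j)).

Hypothesis e0 : forall i, e 0 i = 0.
Hypothesis ah0 : forall i, a 0 i = 0 \/ h 0 i = 0.
Hypothesis eS : forall t i, e t.+1 i = e t i + a t i.
Hypothesis aS : forall t i, a t.+1 i = received t i - h t i.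
Hypothesis hS : forall t i, h t.+1 i = h t i - received t i.

Lemma holes_decr i t t' : t <= t' -> h t' i <= h t i.
Proof.
apply: (@homo_leq _ (h^~ i) (fun x y => y <= x)) => //.
  by move=> x y z xy yz; apply: leq_trans yz xy.
by move=> s; rewrite hS leq_subr.
Qed.

Lemma eventually_no_hole i :
  (exists T, forall t, T <= t -> h t i = 0) \/ (forall t, 0 < h t i).
Proof.
have [ht|/existsNP[T hT]] := pselect (forall t, 0 < h t i); [by right | left].
exists T => t /(holes_decr i); move/negP: hT; rewrite -eqn0Ngt => /eqP ->.
by rewrite leqn0 => /eqP.
Qed.

Lemma token_or_hole t i : a t i = 0 \/ h t i = 0.
Proof.
by case: t => [|t]; [exact: ah0 | rewrite aS hS; lia].
Qed.

Lemma sum_received_tokens t : \sum_i received t i = \sum_i a t i.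
Proof.
rewrite /received.
rewrite (sum_received N (fun j k => flow (degree N j) (e t j) (a t j) k)).
by apply: eq_bigr => i _; rewrite flow_sum ?degree_gt0.
Qed.

(** Each absorbed token fills one hole, so tokens minus holes is invariant. *)
Lemma tokens_conserved t :
  \sum_i a t i + \sum_i h 0 i = \sum_i a 0 i + \sum_i h t i.
Proof.
elim: t => // t IHt.
have : \sum_i a t.+1 i + \sum_i h t i = \sum_i received t i + \sum_i h t.+1 i.
  by rewrite -!big_split; apply: eq_bigr => i _; rewrite /= aS hS; lia.
by rewrite sum_received_tokens; lia.
Qed.

Lemma received_total t i :
  \sum_(s < t) received s i + a 0 i + h t i = e t.+1 i + h 0 i.
Proof.
elim: t => [|t IHt]; first by rewrite big_ord0 eS e0.
rewrite big_ord_recr /= eS aS hS.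
move: (\sum_(s < t) received s i) (received t i) IHt => Q q IHt.
lia.
Qed.

Lemma flow_total t i j : edge N i j ->
  e t j %/ degree N j <= \sum_(s < t) received s i.
Proof.
move=> ij; have d0 := degree_gt0 N j.
have kd : index i (nbr_seq N j) < degree N j.
  by rewrite -(eqP (size_nbr_seq N j)) index_mem mem_nbr_seq edge_sym.
(* With the port index included, the bound telescopes. *)
suff : (e t j + index i (nbr_seq N j)) %/ degree N j <= \sum_(s < t) received s i.
  by apply: leq_trans; apply: leq_div2r; apply: leq_addr.
elim: t => [|t IHt]; first by rewrite e0 add0n divn_small.
rewrite big_ord_recr /= eS.
suff : flow (degree N j) (e t j) (a t j) (index i (nbr_seq N j)) <= received t i.
  rewrite /flow leq_subLR => /leq_trans; apply.
  by rewrite leq_add2r.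
by rewrite /received (bigD1_seq j) ?mem_nbr_seq ?nbr_seq_uniq //= leq_addr.
Qed.

(* A node that always has a hole emits nothing, so it receives only finitely
   many tokens; by the round-robin rule its neighbours emit only finitely many
   tokens, hence receive only finitely many, and so on. *)
Lemma tokens_vanish v : (forall t, 0 < h t v) -> exists t, \sum_i a t i = 0.
Proof.
move=> hv; apply: contrapT => H.
have apos t : 0 < \sum_i a t i.
  by rewrite lt0n; apply/eqP => at0; apply: H; exists t.
have /fin_all_exists[B BP] : forall i, exists B, forall t, e t i <= B.
  apply: (network_ind (N := N) (v := v)) => [|i j ij [B BP]].
    exists 0; elim=> [|t IHt]; first by rewrite e0.
    by rewrite eS; have := token_or_hole t v; have := hv t; lia.
  (* Node [i] emits at most [B] tokens and absorbs at most [h 0 i], so [j] sends it at most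
     [B + h 0 i]. *)
  exists ((B + h 0 i).+1 * degree N j) => t.
  rewrite ltnW // -ltn_divLR ?degree_gt0 // ltnS.
  apply: leq_trans (flow_total t ij) _.
  by move: (received_total t i) (BP t.+1); move: (\sum_(s < t) _) => Q; lia.
have grow t : t <= \sum_i e t i.
  elim: t => // t IHt; under eq_bigr do rewrite eS.
  by rewrite big_split -addn1 leq_add.
have := grow (\sum_i B i).+1.
have : \sum_i e (\sum_i B i).+1 i <= \sum_i B i by apply: leq_sum => i _.
lia.
Qed.

Lemma holes_persist :
  \sum_i a 0 i < \sum_i h 0 i -> exists v, forall t, 0 < h t v.
Proof.
move=> lt; apply: contrapT => H.
have /fin_eventually[T /(_ T (leqnn _)) hT] :
    forall i, exists T, forall t, T <= t -> h t i = 0.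
  by move=> i; case: (eventually_no_hole i) => // hi; case: H; exists i.
have := tokens_conserved T; rewrite [X in _ = _ + X]big1 // addn0 => E.
by move: lt; rewrite -E ltnNge leq_addl.
Qed.

(** A permanent hole would make all tokens vanish at some time; conservation then leaves no hole at
    that time. *)
Lemma holes_filled : \sum_i h 0 i <= \sum_i a 0 i ->
  exists T, forall t, T <= t -> forall i, h t i = 0.
Proof.
move=> le; apply: fin_eventually => i.
case: (eventually_no_hole i) => // hi; have [t at0] := tokens_vanish hi.
have := tokens_conserved t; rewrite at0 add0n => E.
have : \sum_j h t j == 0 by rewrite -leqn0 -(leq_add2l (\sum_j a 0 j)) -E addn0.
by rewrite sum_nat_eq0 => /forallP/(_ i) /=; rewrite eqn0Ngt hi.
Qed.

End Tokens.

(** * The finite-state rule deciding a threshold *)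

Section ThresholdRule.
Local Open Scope nat_scope.
Variables (X : Type) (m : nat) (w : X -> nat) (c : nat).

(* The rotor is the number of tokens emitted so far modulo [d], and the counters
   are kept modulo 3. *)
Definition node_state (d : nat) : finType :=
  ('I_m.+1 * 'I_(m * d).+1 * 'I_d.+1 * ('I_3 * 'I_3 * bool))%type.
Definition packet : finType := ('I_m.+1 * ('I_3 * 'I_3))%type.

Definition holes d (s : node_state d) : nat := s.1.1.1.
Definition tokens d (s : node_state d) : nat := s.1.1.2.
Definition rotor d (s : node_state d) : nat := s.1.2.
Definition quiet d (s : node_state d) : nat := s.2.1.1.
Definition alarm d (s : node_state d) : nat := s.2.1.2.

(* The counters of neighbours differ by at most one, so that their residues
   modulo 3 are enough to compare them. *)
Definition not_behind (k : nat) := all (fun l : nat => l.+1 %% 3 != k).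
Definition some_ahead (k : nat) := has (fun l : nat => l == k.+1 %% 3).

Definition quiet_ticks d (s : node_state d) (ms : seq packet) :=
  (holes s == 0) && not_behind (quiet s) [seq val u.2.1 | u <- ms].
Definition alarm_ticks d (s : node_state d) (ms : seq packet) :=
  let ls := [seq val u.2.2 | u <- ms] in
  ((holes s != 0) || some_ahead (alarm s) ls) && not_behind (alarm s) ls.

(** A quiet tick sets the output bit, an alarm tick alone clears it. No [inord] truncates when [c]
    and all weights are at most [m] and the degree is positive. *)
Definition threshold_rule : local_rule X node_state packet bool :=
  LocalRule
    (fun d x => (inord (c - w x), inord (w x - c), inord 0,
                 (inord 0, inord 0, false)))
    (fun d s k => (inord (flow d (rotor s) (tokens s) k), s.2.1))
    (fun d s ms =>
       let r := \sum_(u <- ms) val u.1 in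
       (inord (holes s - r), inord (r - holes s),
        inord ((rotor s + tokens s) %% d),
        (inord ((quiet s + quiet_ticks s ms) %% 3),
         inord ((alarm s + alarm_ticks s ms) %% 3),
         quiet_ticks s ms || ~~ alarm_ticks s ms && s.2.2)))
    (fun d s => s.2.2).

Hypothesis cm : c <= m.
Hypothesis wm : forall x, w x <= m.

Variables (n : nat) (N : network n) (x : 'I_n -> X).

Let st := trajectory threshold_rule N x.
Let h t i := holes (st t i).
Let a t i := tokens (st t i).

Let inbox t i : seq packet :=
  [seq send threshold_rule (st t j) (index i (nbr_seq N j)) | j <- nbr_seq N i].

(** Unbounded counts, used only in the proof; the states hold their residues. *)
Fixpoint emitted t i := if t is t'.+1 then emitted t' i + a t' i else 0.

Fixpoint quiet_count t i :=
  if t is t'.+1 then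
    quiet_count t' i + ((h t' i == 0) && lagging N (quiet_count t') i)
  else 0.

Fixpoint alarm_count t i :=
  if t is t'.+1 then
    alarm_count t' i + (((h t' i != 0) || leading N (alarm_count t') i)
                        && lagging N (alarm_count t') i)
  else 0.

Lemma inbox_sum t i : (forall j, rotor (st t j) = emitted t j %% degree N j) ->
  \sum_(u <- inbox t i) val u.1 = received N emitted a t i.
Proof.
move=> rot; rewrite big_map; apply: eq_bigr => j _ /=.
rewrite inordK ?rot ?flow_mod ?degree_gt0 //.
rewrite ltnS; apply: flow_le; first exact: degree_gt0.
by rewrite -ltnS; apply: ltn_ord.
Qed.

(** At most [m] tokens arrive per edge, so the capacity [m * d] is preserved. *)
Lemma inbox_sum_le t i : \sum_(u <- inbox t i) val u.1 <= m * degree N i.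
Proof.
rewrite big_map -(eqP (size_nbr_seq N i)) mulnC -sum1_size big_distrl /=.
by apply: leq_sum => j _; rewrite mul1n -ltnS; apply: ltn_ord.
Qed.

Lemma rotorE t i : rotor (st t i) = emitted t i %% degree N i.
Proof.
have d0 := degree_gt0 N i.
elim: t => [|t IHt]; rewrite /rotor /= inordK ?mod0n //.
  by rewrite -/(rotor _) IHt modnDml.
by rewrite ltnS ltnW // ltn_mod.
Qed.

Lemma holesS t i : h t.+1 i = h t i - received N emitted a t i.
Proof.
rewrite -(inbox_sum i (rotorE t)) /h /holes /= inordK //.
by rewrite ltnS (leq_trans (leq_subr _ _)) // -ltnS; apply: ltn_ord.
Qed.

Lemma tokensS t i : a t.+1 i = received N emitted a t i - h t i.
Proof.
rewrite -(inbox_sum i (rotorE t)) /a /tokens /= inordK //.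
by rewrite ltnS (leq_trans (leq_subr _ _)) // inbox_sum_le.
Qed.

Lemma holes0 i : h 0 i = c - w (x i).
Proof.
by rewrite /h /holes /= inordK // ltnS (leq_trans (leq_subr _ _)).
Qed.

Lemma tokens0 i : a 0 i = w (x i) - c.
Proof.
rewrite /a /tokens /= inordK // ltnS (leq_trans (leq_subr _ _)) //.
by rewrite (leq_trans (wm _)) // leq_pmulr ?degree_gt0.
Qed.

Lemma not_behindE (C : 'I_n -> nat) i :
  (forall j k, edge N j k -> C j <= (C k).+1) ->
  not_behind (C i %% 3) [seq C j %% 3 | j <- nbr_seq N i] = lagging N C i.
Proof.
move=> smooth; rewrite /not_behind all_map; apply: eq_in_all => j /=.
rewrite mem_nbr_seq => ij; have := smooth i j ij.
by rewrite edge_sym in ij; have := smooth j i ij; lia.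
Qed.

Lemma some_aheadE (C : 'I_n -> nat) i :
  (forall j k, edge N j k -> C j <= (C k).+1) ->
  some_ahead (C i %% 3) [seq C j %% 3 | j <- nbr_seq N i] = leading N C i.
Proof.
move=> smooth; rewrite /some_ahead has_map; apply: eq_in_has => j /=.
rewrite mem_nbr_seq => ij; have := smooth i j ij.
by rewrite edge_sym in ij; have := smooth j i ij; lia.
Qed.

Lemma quiet_smooth t i j : edge N i j -> quiet_count t i <= (quiet_count t j).+1.
Proof.
by apply: (ticking_smooth (allowed := fun t i => h t i == 0)).
Qed.

Lemma alarm_smooth t i j : edge N i j -> alarm_count t i <= (alarm_count t j).+1.
Proof.
by apply: (ticking_smooth
  (allowed := fun t i => (h t i != 0) || leading N (alarm_count t) i)).
Qed.

Lemma quiet_ticksE t i :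
  (forall j, quiet (st t j) = quiet_count t j %% 3) ->
  quiet_count t.+1 i = quiet_count t i + quiet_ticks (st t i) (inbox t i).
Proof.
move=> qE; rewrite /= /quiet_ticks qE.
suff -> : [seq val u.2.1 | u : packet <- inbox t i] =
    [seq quiet_count t j %% 3 | j <- nbr_seq N i].
  by rewrite not_behindE //; apply: quiet_smooth.
by rewrite -map_comp; apply: eq_map => j /=; rewrite -qE.
Qed.

Lemma alarm_ticksE t i :
  (forall j, alarm (st t j) = alarm_count t j %% 3) ->
  alarm_count t.+1 i = alarm_count t i + alarm_ticks (st t i) (inbox t i).
Proof.
move=> aE; rewrite /= /alarm_ticks aE.
suff -> : [seq val u.2.2 | u : packet <- inbox t i] =
    [seq alarm_count t j %% 3 | j <- nbr_seq N i].
  by rewrite not_behindE ?some_aheadE //; apply: alarm_smooth.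
by rewrite -map_comp; apply: eq_map => j /=; rewrite -aE.
Qed.

Lemma quietE t i : quiet (st t i) = quiet_count t i %% 3.
Proof.
elim: t i => [|t IHt] i; first by rewrite /quiet /= inordK.
by rewrite quiet_ticksE // /quiet /= inordK ?ltn_mod // -/(quiet _) IHt modnDml.
Qed.

Lemma alarmE t i : alarm (st t i) = alarm_count t i %% 3.
Proof.
elim: t i => [|t IHt] i; first by rewrite /alarm /= inordK.
by rewrite alarm_ticksE // /alarm /= inordK ?ltn_mod // -/(alarm _) IHt modnDml.
Qed.

Lemma threshold_rule_decides : exists T, forall t, T <= t -> forall i,
  answer threshold_rule (trajectory threshold_rule N x t i) =
  (n * c <= \sum_i w (x i)).
Proof.
rewrite -/st.
have bS t i : answer threshold_rule (st t.+1 i) = quiet_ticks (st t i) (inbox t i) ||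
  ~~ alarm_ticks (st t i) (inbox t i) && answer threshold_rule (st t i) by [].
have qS t i := quiet_ticksE i (quietE t); have aS t i := alarm_ticksE i (alarmE t).
have qincr i t : quiet_count t i <= quiet_count t.+1 i by rewrite leq_addr.
have aincr i t : alarm_count t i <= alarm_count t.+1 i by rewrite leq_addr.
have excl i : a 0 i = 0 \/ h 0 i = 0 by rewrite tokens0 holes0; lia.
(* The initial excess of tokens over holes is the total weight minus [n * c]. *)
have balance : \sum_i a 0 i + n * c = \sum_i h 0 i + \sum_i w (x i).
  rewrite -[n in n * c]card_ord -sum_nat_const -!big_split.
  by apply: eq_bigr => i _; rewrite /= tokens0 holes0; lia.
apply: fin_eventually => i.
case: leqP => cw.
  (* Enough weight: the holes vanish, the alarm counters are bounded and the quiet ones tick for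
     ever. *)
  have /(holes_filled (N := N)(e := emitted)) [] // : \sum_i h 0 i <= \sum_i a 0 i.
    by rewrite -(leq_add2r (n * c)) balance leq_add2l.
  - exact: tokensS.
  - exact: holesS.
  move=> T hT.
  have [B BP] := pulled_bounded
    (allowed := fun t i => (h t i != 0) || leading N (alarm_count t) i)
    (c := alarm_count) (source := fun t i => h t i != 0) (fun _ _ => erefl)
    (fun _ _ => erefl) (T := T) (fun t Tt i => negbT (negbF (introT eqP (hT t Tt i)))) i.
  apply: (latch_eventually (s := quiet_count^~ i) (s' := alarm_count^~ i)) BP => //.
  - by move=> t; rewrite qS bS; case: quiet_ticks => //; lia.
  - move=> t; rewrite qS aS bS.
    by case: quiet_ticks; case: alarm_ticks => //=; lia.
  - move=> k; have [] := ticking_unbounded (N := N) (c := quiet_count)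
      (allowed := fun t i => h t i == 0) (T := T) _ _ k => //.
      by move=> t Tt j; apply/eqP/hT.
    by move=> t /(_ i); exists t.
(* Too little weight: a permanent hole at [v] blocks the quiet counters and drives the alarm
   counters. *)
have [] := holes_persist (N := N) (e := emitted) (a := a) (h := h) => //.
- exact: tokensS.
- exact: holesS.
- by rewrite -(ltn_add2r (n * c)) balance ltn_add2l.
move=> v hv.
have [] := ticking_bounded (N := N) (c := quiet_count) (v := v)
    (allowed := fun t i => h t i == 0) _ _ _ i => //.
  by move=> t; rewrite -lt0n.
move=> B BP.
apply: (latch_eventually (s := alarm_count^~ i) (s' := quiet_count^~ i)) BP => //.
- move=> t; rewrite qS aS bS.
  by case: quiet_ticks; case: alarm_ticks => //=; lia.
- move=> t; rewrite qS aS bS.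
  by case: quiet_ticks; case: alarm_ticks => //=; lia.
move=> k; have [] := pulled_unbounded
    (allowed := fun t i => (h t i != 0) || leading N (alarm_count t) i)
    (c := alarm_count) (N := N) (source := fun t i => h t i != 0) _ _ (v := v) _ k => //.
  by move=> t; rewrite -lt0n.
by move=> t /(_ i); exists t.
Qed.

End ThresholdRule.

(** * Post-processing of outputs *)

Section Relabelling.
Variables (X : Type) (S : nat -> Type) (M Y Y' : Type) (g : Y -> Y').
Variable r : local_rule X S M Y.

Definition relabel_rule : local_rule X S M Y' :=
  LocalRule (start r) (send r) (update r) (fun d s => g (answer r (d := d) s)).

Lemma trajectory_relabel n (N : network n) (x : 'I_n -> X) t i :
  trajectory relabel_rule N x t i = trajectory r N x t i.
Proof. by []. Qed.

End Relabelling.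

(** * Cells of the simplex and their computability *)

Section Cells.
Variables (K m : nat).

(* The index [(k, q)] stands for the test [q / m <= p_k]. *)
Definition test : finType := ('I_K.+1 * 'I_m.+1)%type.

(** Weight [m] on the nodes with value [k] and threshold [q] amount to [n * q <= m * n * p_k]. *)
Definition test_rule (u : test) :=
  threshold_rule m (fun y : 'I_K.+1 => if y == u.1 then m else 0%N) u.2.

Definition count_cell n (x : {ffun 'I_n -> 'I_K.+1}) : {ffun test -> bool} :=
  [ffun u : test => (n * u.2 <= m * #|[set i | x i == u.1]%SET|)%N].

Lemma computable_count_cell (Y : finType) (g : {ffun test -> bool} -> Y) :
  computable_family (fun n x => g (@count_cell n x)).
Proof.
pose m0 : {ffun test -> packet m} := [ffun=> (ord0, (ord0, ord0))].
apply: (computable_rule m0 (r := relabel_rule g (product_rule test_rule))).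
move=> n N x.
have [T TP] : exists T, forall t, (T <= t)%N -> forall u i,
    answer (test_rule u) (trajectory (test_rule u) N x t i) = count_cell x u.
  apply: fin_eventually => u.
  have [||T TP] := @threshold_rule_decides _ m
    (fun y : 'I_K.+1 => if y == u.1 then m else 0%N) u.2 _ _ n N x.
  - by rewrite -ltnS.
  - by move=> y; case: ifP.
  exists T => t /TP tP i; rewrite tP ffunE; congr (_ <= _)%N.
  by rewrite -big_mkcond sum_nat_const mulnC cardsE.
exists T => t Tt i.
rewrite trajectory_relabel -[LHS]/(g (answer (product_rule test_rule) _)).
congr g; apply/ffunP => u.
by rewrite -(TP t Tt u i) -trajectory_product [LHS]ffunE.
Qed.

Variable R : realType.

Definition cell (p : 'rV[R]_K.+1) : {ffun test -> bool} :=
  [ffun u : test => u.2%:R <= m%:R * p 0 u.1].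

Lemma cell_frequencies n (x : {ffun 'I_n -> 'I_K.+1}) : (0 < n)%N ->
  cell (frequencies R x) = count_cell x.
Proof.
move=> n0; apply/ffunP => u; rewrite !ffunE mxE mulrA ler_pdivlMr ?ltr0n //.
by rewrite -!natrM ler_nat mulnC.
Qed.

(** Let [p_k < q_k] and let [j] be the integer part of [m * q_k]. The test [j] holds at [q], hence
    at [p], so [m * p_k >= j > m * q_k - 1]. *)
Lemma cell_close (p q : 'rV[R]_K.+1) k : (0 < m)%N ->
  0 <= p 0 k <= 1 -> 0 <= q 0 k <= 1 -> cell p = cell q ->
  `|p 0 k - q 0 k| <= m%:R^-1.
Proof.
move=> m0 p01 q01 pq; have m0R : 0 < m%:R :> R by rewrite ltr0n.
wlog lt : p q p01 q01 pq / p 0 k < q 0 k.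
  move=> H; case: (ltgtP (p 0 k) (q 0 k)) => [lt|lt|->].
  - exact: H.
  - by rewrite distrC; apply: H.
  - by rewrite subrr normr0 invr_ge0 ltW.
rewrite distrC gtr0_norm ?subr_gt0 // -(ler_pM2l m0R) mulfV ?gt_eqF //.
set j := Num.truncn (m%:R * q 0 k).
have q0 : 0 <= m%:R * q 0 k by rewrite mulr_ge0 ?(ltW m0R) //; case/andP: q01.
have /andP[jq qj] := truncn_itv q0.
have jm : (j < m.+1)%N.
  rewrite ltnS -(ler_nat R) (le_trans jq) // ler_piMr ?(ltW m0R) //.
  by case/andP: q01.
have /ffunP/(_ (k, Ordinal jm)) := pq; rewrite !ffunE /= jq => jp.
by rewrite mulrBr lerBlDl; apply: le_trans (ltW qj) _; rewrite -natr1 lerD2r jp.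
Qed.

End Cells.

(** * Compactness and uniform continuity *)

Section Simplex.
Variables (R : realType) (K : nat).

Lemma unit_simplex_compact : compact (unit_simplex R K).
Proof.
have -> : unit_simplex R K =
    [set p : 'rV[R]_K.+1 | forall k, `[0, 1] (p ord0 k)] `&`
    [set p : 'rV[R]_K.+1 | \sum_k p 0 k = 1].
  by apply/seteqP; split=> p [p01 p1]; split.
apply: compact_closedI.
  have := @rV_compact R K.+1 (fun=> `[(0:R), 1]%classic); apply=> _; exact: segment_compact.
apply: (@preimage_closed _ _ (fun p : 'rV[R]_K.+1 => \sum_k p 0 k) [set x | x = 1]).
  move=> p _; apply: continuous_big => [|k _].
    by move=> q; apply: add_continuous.
  exact: coord_continuous.
exact: closed_eq.
Qed.

(** Heine-Cantor, by near-covering compactness along [m] tending to infinity. *)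
Lemma compact_uniform_modulus (D : set 'rV[R]_K) (h : 'rV[R]_K -> R) (eps : R) :
  compact D -> {within D, continuous h} -> 0 < eps ->
  exists m : nat, forall p q : 'rV[R]_K, D p -> D q ->
    (forall k, `|p 0 k - q 0 k| <= m.+1%:R^-1) -> `|h p - h q| < eps.
Proof.
move=> /compact_near_coveringP/near_covering_withinP Dc.
move=> /subspace_continuousP hc eps0.
pose P (m : nat) (p : 'rV[R]_K) := forall q, D q ->
  (forall k, `|p 0 k - q 0 k| <= m.+1%:R^-1) -> `|h p - h q| < eps.
have [m _ mP] : \forall m \near \oo, D `<=` P m.
  apply: Dc => p Dp.
  have /cvgrPdist_lt/(_ (eps / 2)) := hc p Dp.
  rewrite divr_gt0 // => /(_ isT); rewrite near_withinE => /nbhs_ballP[e /= e0 eP].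
  (* Half of the radius is for [p'] near [p], half for [q] near [p']. *)
  have e20 : 0 < e / 2 by rewrite divr_gt0.
  near=> p' m => Dp' q Dq p'q.
  have pp' : ball p (e / 2) p' by near: p'; apply: nbhsx_ballx.
  have me : m.+1%:R^-1 < e / 2.
    by near: m; apply: (near_infty_natSinv_lt (PosNum e20)).
  have hp' : `|h p - h p'| < eps / 2.
    by apply: eP => //; apply: le_ball pp'; lra.
  have hq : `|h p - h q| < eps / 2.
    apply: eP => //; split=> // i k; rewrite (ord1 i).
    have [_ /(_ ord0 k)] := pp'; have := p'q k; rewrite /ball /=.
    move=> le1 lt1; rewrite -(subrKA (p' 0 k)) (le_lt_trans (ler_normD _ _)) //.
    by rewrite (splitr e) ltrD // (le_lt_trans le1).
  rewrite -(subrKA (h p)) (le_lt_trans (ler_normD _ _)) //.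
  by rewrite (splitr eps) ltrD // distrC.
by exists m => p q Dp; apply: (mP m (leqnn m) p Dp).
Unshelve. all: by end_near. Qed.

End Simplex.

Theorem corollary9p5 (R : realType) (K : nat) (L U : R)
    (h : 'rV[R]_K.+1 -> R)
    (h_range : set_fun (unit_simplex R K) `[L, U] h)
    (h_cont : {within unit_simplex R K, continuous h})
    (eps : R) (eps_gt0 : 0 < eps) :
  exists h_eps : 'rV[R]_K.+1 -> R,
    [/\ set_fun (unit_simplex R K) `[L, U] h_eps,
        computable_on_simplex h_eps
      & (sup_norm (unit_simplex R K) (fun p => h p - h_eps p)%R < eps%:E)%E].
Proof.
have eps2 : 0 < eps / 2 by rewrite divr_gt0.
have [m mP] := compact_uniform_modulus (@unit_simplex_compact R K) h_cont eps2.
(* The default 0 is taken only for cells that miss the simplex. *)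
pose rep c := xget 0 [set p : 'rV[R]_K.+1 | unit_simplex R K p /\ cell m.+1 p = c].
have repP p : unit_simplex R K p ->
    unit_simplex R K (rep (cell m.+1 p)) /\ cell m.+1 (rep (cell m.+1 p)) = cell m.+1 p.
  move=> Dp; apply: (xgetPex (P := [set q : 'rV[R]_K.+1 | unit_simplex R K q /\
    cell m.+1 q = cell m.+1 p]) 0).
  by exists p.
pose Y := [fset h (rep c) | c in {: {ffun test K m.+1 -> bool}}]%fset.
have hY c : h (rep c) \in Y by apply: in_imfset.
exists (fun p => h (rep (cell m.+1 p))); split.
- by move=> p /repP[Dp _]; apply: h_range.
- exists Y; split; first by move=> p _; apply: hY.
  exists (fun n x => [` hY (count_cell m.+1 x)]%fset); split.
    by move=> n x n0 /=; rewrite cell_frequencies.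
  exact: (computable_count_cell (fun c => [` hY c]%fset)).
(* A supremum of values below [eps / 2] may equal it, so half of [eps] is kept in reserve. *)
apply: (@le_lt_trans _ _ (eps / 2)%:E); last by rewrite lte_fin; lra.
apply: ge_ereal_sup => _ [p Dp <-]; rewrite lee_fin ltW //.
have [Dr rp] := repP p Dp; apply: mP => // k.
by apply: cell_close => //; [case: Dp | case: Dr].
Qed.
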